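(* A finitely generated $\mathbb{Z}$-module $M$ is weakly uniserial if and only if $M \cong \mathbb{Z}^{n}$ or $M \cong \bigoplus_{n} \mathbb{Z}_{p}$ (the direct sum of $n$ copies of $\mathbb{Z}_p$) or $M \cong \mathbb{Z}_{p^{n}}$, for some prime number $p$ and some integer $n \geq 0$.
   Context: A module $M$ is called weakly uniserial if for any two submodules $N$ and $K$ of $M$ there exists an injective module homomorphism $N\to K$ or an injective module homomorphism $K\to N$. $\mathbb{Z}_m$ denotes $\mathbb{Z}/m\mathbb{Z}$. *)

(* Defs.v *)
From HB Require Import structures.
From mathcomp Require Import all_boot all_order all_algebra.

Set Implicit Arguments.
Unset Strict Implicit.
Unset Printing Implicit Defensive.

Import GRing.Theory.
Local Open Scope ring_scope.

(* Subsets of M are boolean predicates, as everywhere in MathComp; with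
   excluded middle and choice these are all the subsets of M. *)
Section Submodule.
Variables (R : pzRingType) (M : lmodType R) (N : submodClosed M).

Record submodule : Type :=
  Submodule { submodule_val : M; submodule_valP : submodule_val \in N }.

HB.instance Definition _ := [isSub for submodule_val].
HB.instance Definition _ := [Choice of submodule by <:].
HB.instance Definition _ := [SubChoice_isSubLmodule of submodule by <:].

End Submodule.

Definition embeds (R : pzRingType) (U V : lmodType R) : Prop :=
  exists f : {linear U -> V}, injective f.

Definition isomorphic (R : pzRingType) (U V : lmodType R) : Prop :=
  exists f : {linear U -> V}, bijective f.

Definition weakly_uniserial (R : pzRingType) (M : lmodType R) : Prop :=
  forall N K : submodClosed M,
    embeds (submodule N) (submodule K) \/ embeds (submodule K) (submodule N).

Definition finitely_generated (R : pzRingType) (M : lmodType R) : Prop :=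
  exists (n : nat) (g : 'I_n -> M),
    forall x : M, exists c : 'I_n -> R, x = \sum_(i < n) c i *: g i.

(* Z/mZ as a Z-module: addition modulo m on {0, ..., m - 1} if m > 0, and Z
   itself if m = 0. 'Z_m is not used since 'Z_1 has two elements, whereas
   Z/(p ^ 0)Z must be trivial. The wrapper zmodule makes an abelian group a
   Z-module through *~. *)
Definition Zmod (m : nat) : lmodType int :=
  match m with
  | 0 => int^o
  | m'.+1 => zmodule 'I_m'.+1
  end.

Definition direct_power (R : pzRingType) (n : nat) (V : lmodType R) :
  lmodType R := {ffun 'I_n -> V}.

(* Main.v *)
(* Generators g_1, ..., g_n of M all of whose relations are the trivial ones
   modulo m identify M with (Z/m)^n. If a x = 0 happens in M only when m | a or
   x = 0, such generators exist: the Smith form of any other relation exhibits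
   a superfluous generator. This covers Z^n (m = 0) and (Z/p)^n (m = p), and
   the condition passes to submodules, which are again finitely generated; so
   any two submodules are powers of Z/m and embed according to their exponents.
   The submodules of Z/p^n form a chain.

   Conversely, comparing cyclic submodules shows that a weakly uniserial M is
   torsion-free or p-primary for one prime p. In the second case, if p M is not
   0, there is x of order p^2, and comparing M[p] with Zx shows that M[p] is
   cyclic; dividing by p repeatedly, every y is then a multiple of an element of
   maximal order. *)
Require Import Defs.
From HB Require Import structures.
From mathcomp Require Import all_boot all_order all_algebra boolp.

Set Implicit Arguments.
Unset Strict Implicit.
Unset Printing Implicit Defensive.

Import GRing.Theory.
Local Open Scope ring_scope.

(** * Generators, relations and linear maps *)

Definition generates (R : pzRingType) (M : lmodType R) n (g : 'I_n -> M) :=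
  forall x : M, exists c : 'I_n -> R, x = \sum_(i < n) c i *: g i.

Definition Zmod_basis (m : nat) (M : lmodType int) n (g : 'I_n -> M) :=
  generates g /\
  forall c : 'I_n -> int,
    \sum_(i < n) c i *: g i = 0 <-> forall i, (m%:Z %| c i)%Z.

(* For prime m this says that M is a vector space over Z/m, and for m = 0 that
   M is torsion-free. *)
Definition Zmod_homogeneous (m : nat) (M : lmodType int) :=
  forall (a : int) (x : M), a *: x = 0 <-> (m%:Z %| a)%Z \/ x = 0.

(** Choose coefficients for every [x] and replace [g] by [h]. As relations of [g] are relations of
    [h], the result does not depend on the choice, which gives linearity. *)
Lemma linear_extension (R : pzRingType) (M V : lmodType R) n
    (g : 'I_n -> M) (h : 'I_n -> V) :
  generates g ->
  (forall c, \sum_(i < n) c i *: g i = 0 -> \sum_(i < n) c i *: h i = 0) ->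
  exists f : {linear M -> V},
    forall c, f (\sum_(i < n) c i *: g i) = \sum_(i < n) c i *: h i.
Proof.
move=> gen_g rel_gh; have [k kE] := choice gen_g.
have fE c x : \sum_(i < n) c i *: g i = x ->
    \sum_(i < n) k x i *: h i = \sum_(i < n) c i *: h i.
  move=> cE; apply/eqP; rewrite -subr_eq0 -sumrB; apply/eqP.
  under eq_bigr do rewrite -scalerBl.
  apply: rel_gh; under eq_bigr do rewrite scalerBl.
  by rewrite sumrB -kE cE subrr.
pose f x := \sum_(i < n) k x i *: h i.
have f_lin : linear f.
  move=> a x y; rewrite /f (fE (fun i => a * k x i + k y i)); last first.
    rewrite [in RHS](kE x) [in RHS](kE y) scaler_sumr -big_split.
    by apply: eq_bigr => i _; rewrite scalerDl scalerA.
  rewrite scaler_sumr -big_split.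
  by apply: eq_bigr => i _; rewrite scalerDl scalerA.
pose fL := GRing.isLinear.Build R M V *:%R f f_lin.
pose F : {linear M -> V} := HB.pack f fL.
by exists F => c; apply: fE.
Qed.

Lemma embeds_same_relations (R : pzRingType) (M V : lmodType R) n
    (g : 'I_n -> M) (h : 'I_n -> V) :
  generates g ->
  (forall c, \sum_(i < n) c i *: g i = 0 <-> \sum_(i < n) c i *: h i = 0) ->
  embeds M V.
Proof.
move=> gen_g rel_gh.
have [f fE] := linear_extension gen_g (fun c => (rel_gh c).1).
have f0 x : f x = 0 -> x = 0.
  by have [c ->] := gen_g x; rewrite fE => /rel_gh.
by exists f; apply: raddf_inj f0.
Qed.

Lemma isomorphic_same_relations (R : pzRingType) (M V : lmodType R) n
    (g : 'I_n -> M) (h : 'I_n -> V) :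
  generates g -> generates h ->
  (forall c, \sum_(i < n) c i *: g i = 0 <-> \sum_(i < n) c i *: h i = 0) ->
  isomorphic M V.
Proof.
move=> gen_g gen_h rel_gh.
have [f fE] := linear_extension gen_g (fun c => (rel_gh c).1).
have [f' f'E] := linear_extension gen_h (fun c => (rel_gh c).2).
exists f, f' => x; first by have [c ->] := gen_g x; rewrite fE f'E.
by have [c ->] := gen_h x; rewrite f'E fE.
Qed.

Lemma generatesW (M : lmodType int) n (g : 'I_n -> M) k (h : 'I_k -> M) :
  generates g -> (forall i, exists c, g i = \sum_(j < k) c j *: h j) ->
  generates h.
Proof.
move=> gen_g /choice[C gE] x; have [c ->] := gen_g x.
exists (fun j => \sum_(i < n) c i * C i j).
under eq_bigr => i do rewrite gE scaler_sumr.
rewrite exchange_big; apply: eq_bigr => j _; rewrite scaler_suml.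
by apply: eq_bigr => i _; rewrite scalerA.
Qed.

(** * Bases of homogeneous modules *)

Lemma Zmod_homogeneous_basis m (M : lmodType int) :
  finitely_generated M -> Zmod_homogeneous m M ->
  exists n (g : 'I_n -> M), Zmod_basis m g.
Proof.
move=> [n [g gen_g]] homM; elim: n g gen_g => [|n IHn] g gen_g.
  exists 0%N, g; split=> // c; split=> [_ [] //|_]; exact: big_ord0.
have [[c [c0 Nmc]] | all_c] :=
  pselect (exists c, \sum_(i < n.+1) c i *: g i = 0 /\
                     ~ forall i, (m%:Z %| c i)%Z); last first.
  exists n.+1, g; split=> // c; split=> [c0|mc].
    by apply: contrapT => Nmc; apply: all_c; exists c.
  by apply: big1 => i _; apply/homM; left.
(* The Smith form of the relation is a single multiple of a vector that can be
   completed to a basis, so that one generator becomes superfluous. *)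
have [L _ [T uT [d _ cE]]] := int_Smith_normal_form (\row_i c i).
pose a := L ord0 ord0 * d`_0.
have {}cE i : c i = a * T ord0 i.
  have /rowP/(_ i) := cE; rewrite mxE => ->.
  rewrite mxE (bigD1 ord0) //= big1 => [|j Nj0]; last first.
    rewrite mxE big_ord1 mxE; case: j Nj0 => [[|j] ltj] //=.
    by rewrite mulr0n mulr0 mul0r.
  by rewrite addr0 mxE big_ord1 mxE.
pose h j := \sum_(i < n.+1) T j i *: g i.
have gE i : g i = \sum_(j < n.+1) invmx T i j *: h j.
  under eq_bigr => j do rewrite scaler_sumr.
  rewrite exchange_big /= (eq_bigr (fun k => (i == k)%:R *: g k)) => [|k _].
    rewrite (bigD1 i) //= eqxx scale1r big1 ?addr0 // => k.
    by rewrite eq_sym => /negPf->; rewrite scale0r.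
  under eq_bigr => j do rewrite scalerA.
  have /matrixP/(_ i k) := mulVmx uT; rewrite !mxE => <-.
  by rewrite scaler_suml.
(* In the generators [h] the relation reads [a *: h ord0 = 0]. If [m] divided [a], it would divide
   every [c i]; hence [h ord0] vanishes. *)
have /homM[m_a|h0] : a *: h ord0 = 0.
- rewrite -c0 /h scaler_sumr; apply: eq_bigr => i _.
  by rewrite scalerA -cE.
- by case: Nmc => i; rewrite cE dvdz_mulr.
apply: (IHn (fun j => h (lift ord0 j))).
apply: (generatesW gen_g) => i; exists (fun j => invmx T i (lift ord0 j)).
by rewrite gE big_ord_recl h0 scaler0 add0r.
Qed.

(** * Finite generation of submodules *)

(** Division by a nonzero element of least absolute value leaves a remainder in [I], which must
    vanish. If [I] contains only 0, then [d] is 0. *)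
Lemma int_ideal_principal (I : int -> Prop) :
  I 0 -> (forall a b k, I a -> I b -> I (a + k * b)) ->
  exists d, I d /\ forall a, I a -> (d %| a)%Z.
Proof.
move=> I0 Ilin; have [[b [Ib b0]]|I_triv] := pselect (exists b, I b /\ b != 0).
  pose P m := `[< exists2 a, I a & (a != 0) && (`|a|%N == m) >].
  have exP : exists m, P m.
    by exists `|b|%N; apply/asboolP; exists b => //; rewrite b0 eqxx.
  have [m /asboolP[d Id /andP[d0 /eqP dm]] m_min] := ex_minnP exP.
  exists d; split=> // a Ia; apply/dvdz_mod0P/eqP/negPn/negP => r0.
  have : P `|(a %% d)%Z|%N.
    apply/asboolP; exists (a %% d)%Z; last by rewrite r0 eqxx.
    by rewrite /modz -mulNr; apply: Ilin.
  move=> /m_min; rewrite -dm leqNgt => /negP[].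
  by rewrite -ltz_nat gez0_abs ?modz_ge0 // ltz_mod.
exists 0; split=> // a Ia; have [->//|a0] := eqVneq a 0.
by case: I_triv; exists a.
Qed.

(** A predicate inside a span, so that induction can pass to the elements of [P] spanned by the
    remaining generators. The possible coefficients of [g ord0] form an ideal generated by some [d];
    an element [x0] of [P] with coefficient [d] is the one additional generator. *)
Lemma span_submodule_generators (M : lmodType int) n (g : 'I_n -> M)
    (P : M -> Prop) :
  P 0 -> (forall x y a, P x -> P y -> P (x + a *: y)) ->
  (forall x, P x -> exists c, x = \sum_(i < n) c i *: g i) ->
  exists h : 'I_n -> M, (forall i, P (h i)) /\
    forall x, P x -> exists c, x = \sum_(i < n) c i *: h i.
Proof.
elim: n g P => [|n IHn] g P P0 Plin gen_g; first by exists g; split=> // -[].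
pose g' i := g (lift ord0 i).
pose I a := exists c, P (a *: g ord0 + \sum_(i < n) c i *: g' i).
have [||d [[e Pe] d_dvd]] := @int_ideal_principal I.
- exists (fun=> 0); rewrite scale0r add0r big1 // => i _; exact: scale0r.
- move=> a b k [c Pc] [c' Pc']; exists (fun i => c i + k * c' i).
  have := Plin _ _ k Pc Pc'; congr P.
  rewrite scalerDr addrACA scalerA -scalerDl scaler_sumr -big_split /=.
  by congr (_ + _); apply: eq_bigr => i _; rewrite scalerDl scalerA.
set x0 := (X in P X) in Pe.
pose P' x := P x /\ exists c, x = \sum_(i < n) c i *: g' i.
have [||x []//|h' [Ph' gen_h']] := IHn g' P'.
- by split=> //; exists (fun=> 0); rewrite big1 // => i _; rewrite scale0r.
- move=> x y a [Px [c xE]] [Py [c' yE]]; split; first exact: Plin.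
  exists (fun i => c i + a * c' i); rewrite xE yE scaler_sumr -big_split /=.
  by apply: eq_bigr => i _; rewrite scalerDl scalerA.
pose h i := if unlift ord0 i is Some j then h' j else x0.
have h0 : h ord0 = x0 by rewrite /h unlift_none.
have hS i : h (lift ord0 i) = h' i by rewrite /h liftK.
exists h; split=> [i|x Px].
  by case: (unliftP ord0 i) => [j|] ->; rewrite ?h0 ?hS //; have [] := Ph' j.
have [c cE] := gen_g _ Px.
have /d_dvd/dvdzP[q c0] : I (c ord0).
  by exists (fun i => c (lift ord0 i)); rewrite big_ord_recl in cE; rewrite -cE.
(* Subtracting [q *: x0] cancels the coefficient of [g ord0]. *)
have /gen_h'[b bE] : P' (x + (- q) *: x0).
  split; first exact: Plin.
  exists (fun i => c (lift ord0 i) - q * e i).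
  rewrite cE big_ord_recl c0 /x0 scalerDr scaleNr scalerA addrACA subrr add0r.
  rewrite scaleNr scaler_sumr -sumrB.
  by apply: eq_bigr => i _; rewrite scalerBl scalerA.
exists (fun i => if unlift ord0 i is Some j then b j else q).
rewrite big_ord_recl unlift_none h0.
under eq_bigr => i _ do rewrite liftK hS.
by rewrite -bE scaleNr addrC subrK.
Qed.

Lemma submodule_fg (M : lmodType int) (N : submodClosed M) :
  finitely_generated M -> finitely_generated (submodule N).
Proof.
move=> [n [g gen_g]].
have [||x _|h [Nh gen_h]] :=
  @span_submodule_generators M n g (fun x => x \in N).
- exact: rpred0.
- by move=> x y a Nx Ny; rewrite rpredD ?rpredZ.
- exact: gen_g.
exists n, (fun i => Submodule (Nh i)) => x.
have [c cE] := gen_h _ (submodule_valP x).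
exists c; apply: val_inj; rewrite [LHS]cE raddf_sum.
by apply: eq_bigr => i _.
Qed.

(** * The modules Z/m and their powers *)

Lemma Zmod_basis1 m : exists e : Zmod m,
  (forall x, exists a, x = a *: e) /\
  forall a : int, a *: e = 0 <-> (m%:Z %| a)%Z.
Proof.
case: m => [|m].
  exists 1; split=> [x|a]; first by exists x; rewrite [RHS]mulr1.
  by rewrite [_ *: _]mulr1 dvd0z; split=> [->|/eqP].
(* The class of 1; in the trivial group ['I_1] it is 0, as it should be. *)
pose e : zmodule 'I_m.+1 := inZp 1.
have eM (k : nat) : k%:Z *: e = inZp k.
  by apply: val_inj; rewrite [k%:Z *: e]Zp_mulrn /= modnMml mul1n.
have e0 (k : nat) : k%:Z *: e = 0 <-> (m.+1 %| k)%N.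
  rewrite eM /dvdn; split=> [/(congr1 val) /= ->//|/eqP k0].
  exact: val_inj.
exists e; split=> [x|a]; first by exists (x : nat)%:Z; rewrite eM [RHS]valZpK.
rewrite dvdzE /= -e0; case: (intP a) => [||k] //.
rewrite scaleNr abszN; split=> /eqP; rewrite ?oppr_eq0 => /eqP-> //.
exact: oppr0.
Qed.

Lemma Zmod_has_basis m : exists e : 'I_1 -> Zmod m, Zmod_basis m e.
Proof.
have [e [gen_e e0]] := Zmod_basis1 m; exists (fun=> e); split=> [x|c].
  by have [a ->] := gen_e x; exists (fun=> a); rewrite big_ord1.
by rewrite big_ord1 e0; split=> [c0 i|//]; rewrite (ord1 i).
Qed.

Lemma direct_power_Zmod_basis n m :
  exists g : 'I_n -> direct_power n (Zmod m), Zmod_basis m g.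
Proof.
have [e [gen_e e0]] := Zmod_basis1 m.
pose g i : direct_power n (Zmod m) := [ffun j => if i == j then e else 0].
have gE c j : (\sum_(i < n) c i *: g i) j = c j *: e.
  rewrite sum_ffunE (bigD1 j) //= !ffunE eqxx big1 ?addr0 // => i Nij.
  by rewrite !ffunE (negPf Nij) scaler0.
exists g; split=> [x|c].
  have [c cE] := choice (fun j => gen_e (x j)).
  by exists c; apply/ffunP => j; rewrite gE cE.
split=> [c0 i|mc]; last by apply/ffunP => j; rewrite gE ffunE; apply/e0.
by apply/e0; rewrite -gE c0 ffunE.
Qed.

(** * Homogeneous modules are weakly uniserial *)

Lemma Zmod_homogeneous_inj m (M V : lmodType int) (f : {linear M -> V}) :
  injective f -> Zmod_homogeneous m V -> Zmod_homogeneous m M.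
Proof.
move=> f_inj homV a x; have f0 y : f y = 0 -> y = 0.
  by rewrite -[0](raddf0 f) => /f_inj.
split=> [ax0|ax].
  have /homV[] : a *: f x = 0 by rewrite -linearZ ax0 raddf0.
  - by left.
  - by move/f0; right.
apply: f0; rewrite linearZ; apply/homV.
by case: ax => [|->]; [left|right; rewrite raddf0].
Qed.

(** In coordinates, [a *: x = 0] says that [m] divides every [a * c i]. Absence of zero divisors in
    Z, or Euclid's lemma, separates the factors. *)
Lemma direct_power_homogeneous n m :
  m = 0%N \/ prime m -> Zmod_homogeneous m (direct_power n (Zmod m)).
Proof.
move=> m0p; have [g [gen_g g0]] := direct_power_Zmod_basis n m => a x.
have [c ->] := gen_g x; rewrite scaler_sumr.
under eq_bigr do rewrite scalerA.
rewrite !g0; split=> [mac|[ma i|mc i]]; last 2 first.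
- exact: dvdz_mulr.
- exact: dvdz_mull.
have [ma|Nma] := boolP (m%:Z %| a)%Z; [by left | right=> i].
have := mac i; case: m0p => [m0|pr_m].
  by move: Nma; rewrite m0 !dvd0z mulf_eq0 => /negPf->.
by rewrite dvdzE abszM Euclid_dvdM // -!dvdzE (negPf Nma).
Qed.

(** Send [g] to the first [k] members of [h]: a relation among these is a relation of [h] padded
    with zeros. *)
Lemma Zmod_basis_embeds m (M V : lmodType int) k l
    (g : 'I_k -> M) (h : 'I_l -> V) :
  (k <= l)%N -> Zmod_basis m g -> Zmod_basis m h -> embeds M V.
Proof.
move=> le_kl [gen_g g0] [_ h0].
move: h h0; rewrite -(subnKC le_kl); move: (l - k)%N => d h h0.
apply: (@embeds_same_relations _ _ _ _ g (fun i => h (lshift d i))) => // c.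
pose c' (j : 'I_(k + d)) := if split j is inl i then c i else 0.
have c'l i : c' (lshift d i) = c i by rewrite /c' (unsplitK (inl i)).
have c'r i : c' (rshift k i) = 0 by rewrite /c' (unsplitK (inr i)).
have -> : \sum_(i < k) c i *: h (lshift d i) = \sum_j c' j *: h j.
  rewrite big_split_ord /= [X in _ + X]big1 ?addr0 => [|i _].
    by apply: eq_bigr => i _; rewrite c'l.
  by rewrite c'r scale0r.
rewrite g0 h0; split=> [mc j|mc' i]; last by rewrite -c'l.
by rewrite -(splitK j); case: (split j) => i /=; rewrite ?c'l ?c'r ?dvdz0.
Qed.

Lemma homogeneous_weakly_uniserial m (M : lmodType int) :
  finitely_generated M -> Zmod_homogeneous m M -> weakly_uniserial M.
Proof.
move=> fgM homM.
have basisN (N : submodClosed M) :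
    exists n (g : 'I_n -> submodule N), Zmod_basis m g.
  apply: Zmod_homogeneous_basis (submodule_fg N fgM) _.
  pose f : {linear submodule N -> M} := val.
  exact: (@Zmod_homogeneous_inj _ _ _ f val_inj).
move=> N K; have [k [g bg]] := basisN N; have [l [h bh]] := basisN K.
by case/orP: (leq_total k l) => le_kl; [left|right];
   apply: Zmod_basis_embeds le_kl _ _; eassumption.
Qed.

(** * Submodules of cyclic p-groups *)

Lemma submodule_sub_embeds (R : pzRingType) (M : lmodType R)
    (N K : submodClosed M) :
  {subset N <= K} -> embeds (submodule N) (submodule K).
Proof.
move=> sNK; pose f (x : submodule N) := Submodule (sNK _ (submodule_valP x)).
have f_lin : linear f by move=> a x y; apply: val_inj.
pose fL := GRing.isLinear.Build R (submodule N) (submodule K) *:%R f f_lin.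
pose F : {linear submodule N -> submodule K} := HB.pack f fL.
by exists F => x y /(congr1 val) xy; apply: val_inj.
Qed.

(** By Bezout, [y] is a multiple of [x] modulo [q] once [gcdz x q] divides [gcdz y q]. Here both
    gcds are powers of [p], so one divides the other. *)
Lemma prime_power_multiples p n (a b : int) : prime p ->
  exists c, (Posz (p ^ n) %| b - c * a)%Z \/ (Posz (p ^ n) %| a - c * b)%Z.
Proof.
move=> pr_p; set q := Posz (p ^ n).
have multiple x y : (gcdz x q %| gcdz y q)%Z -> exists c, (q %| y - c * x)%Z.
  move=> xy; have /dvdzP[r yE] := dvdz_trans xy (dvdz_gcdl y q).
  have [u [v uv]] := Bezoutz x q; exists (r * u).
  by rewrite yE -uv mulrDr !mulrA addrAC subrr add0r dvdz_mull.
have gcdE x : exists i, `|gcdz x q|%N = (p ^ i)%N.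
  have : (`|gcdz x q| %| p ^ n)%N by rewrite dvdn_gcdr.
  by case/(dvdn_pfactor _ _ pr_p)=> i _ xE; exists i.
have [i iE] := gcdE a; have [j jE] := gcdE b.
by case/orP: (leq_total i j) => le_ij;
  [have [|c] := multiple a b | have [|c] := multiple b a];
  rewrite ?dvdzE ?iE ?jE ?dvdn_exp2l //; exists c; [left | right].
Qed.

(** Of any two elements one is a multiple of the other, so submodules are comparable by
    inclusion. *)
Lemma cyclic_weakly_uniserial p n (M : lmodType int) (x : M) : prime p ->
  (forall y, exists a, y = a *: x) -> Posz (p ^ n) *: x = 0 ->
  weakly_uniserial M.
Proof.
move=> pr_p gen_x x0 N K.
have [sNK|NsNK] := pselect ({subset N <= K}).
  by left; apply: submodule_sub_embeds.
right; apply: submodule_sub_embeds => z Kz; apply: contrapT => NNz.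
apply: NsNK => y Ny; have [a yE] := gen_x y; have [b zE] := gen_x z.
have eq_mod r s : (Posz (p ^ n) %| r - s)%Z -> r *: x = s *: x.
  case/dvdzP=> q /(congr1 (fun t => t *: x)).
  by rewrite -scalerA x0 scaler0 scalerBl => /eqP; rewrite subr_eq0 => /eqP.
have [c [/eq_mod zc|/eq_mod yc]] := prime_power_multiples n a b pr_p.
  by case: NNz; rewrite zE zc -scalerA -yE rpredZ.
by rewrite yE yc -scalerA -zE rpredZ.
Qed.

Lemma Zmod_prime_power_weakly_uniserial p n (M : lmodType int) : prime p ->
  isomorphic M (Zmod (p ^ n)) -> weakly_uniserial M.
Proof.
move=> pr_p [f [f' fK f'K]]; have [e [gen_e e0]] := Zmod_basis1 (p ^ n).
apply: (@cyclic_weakly_uniserial p n M (f' e)) => // [y|].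
  have [a yE] := gen_e (f y); exists a; apply: (can_inj fK).
  by rewrite yE linearZ f'K.
by apply: (can_inj fK); rewrite linearZ f'K raddf0; apply/e0.
Qed.

(** * Comparison of the submodules Zx and M[a] *)

Definition multiples (M : lmodType int) (x : M) : {pred M} :=
  [pred y | `[< exists a : int, y = a *: x >]].

Lemma multiples_submod_closed (M : lmodType int) (x : M) :
  submod_closed (multiples x).
Proof.
split=> [|a y z]; first by apply/asboolP; exists 0; rewrite scale0r.
move=> /asboolP[b ->] /asboolP[c ->]; apply/asboolP.
by exists (a * b + c); rewrite scalerDl scalerA.
Qed.

HB.instance Definition _ (M : lmodType int) (x : M) :=
  GRing.isSubmodClosed.Build int M (multiples x)
    (GRing.submod_closed_semi (multiples_submod_closed x)).

Definition torsion (M : lmodType int) (a : int) : {pred M} :=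
  [pred y | a *: y == 0].

Lemma torsion_submod_closed (M : lmodType int) (a : int) :
  submod_closed (@torsion M a).
Proof.
split=> [|b y z]; first by rewrite inE scaler0.
rewrite !inE => /eqP ay0 /eqP az0.
by rewrite scalerDr scalerA mulrC -scalerA ay0 az0 scaler0 addr0.
Qed.

HB.instance Definition _ (M : lmodType int) (a : int) :=
  GRing.isSubmodClosed.Build int M (@torsion M a)
    (GRing.submod_closed_semi (@torsion_submod_closed M a)).

Lemma embeds_submodule_val (R : pzRingType) (M : lmodType R)
    (N K : submodClosed M) : embeds (submodule N) (submodule K) ->
  exists f : {linear submodule N -> M},
    injective f /\ forall u, f u \in K.
Proof.
move=> [f f_inj]; pose v : {linear submodule K -> M} := val.
exists (v \o f); split; first exact: inj_comp val_inj f_inj.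
by move=> u; apply: submodule_valP.
Qed.

(** The image of [x] is some [b *: y], and injective maps preserve annihilators. *)
Lemma multiples_embed (M : lmodType int) (x y : M) :
  embeds (submodule (multiples x)) (submodule (multiples y)) ->
  exists b : int, forall a : int, a *: x = 0 <-> a *: (b *: y) = 0.
Proof.
case/embeds_submodule_val=> f [f_inj f_y].
have xx : x \in multiples x by apply/asboolP; exists 1; rewrite scale1r.
have /asboolP[b bE] := f_y (Submodule xx).
exists b => a; rewrite -bE -linearZ; split=> [ax0|].
  by rewrite -[RHS](raddf0 f); congr (f _); apply: val_inj.
by rewrite -[0 in X in X -> _](raddf0 f) => /f_inj/(congr1 val).
Qed.

Lemma weakly_uniserial_elements (M : lmodType int) (x y : M) :
  weakly_uniserial M ->
  exists b : int, (forall a : int, a *: x = 0 <-> a *: (b *: y) = 0) \/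
    (forall a : int, a *: y = 0 <-> a *: (b *: x) = 0).
Proof.
move=> wuM.
by case: (wuM (multiples x) (multiples y)) => /multiples_embed[b bE];
  exists b; [left | right].
Qed.

(** * Recognition of powers of Z/m *)

Lemma Zmod_basis_isomorphic m (M V : lmodType int) n
    (g : 'I_n -> M) (h : 'I_n -> V) :
  Zmod_basis m g -> Zmod_basis m h -> isomorphic M V.
Proof.
move=> [gen_g g0] [gen_h h0]; apply: (isomorphic_same_relations gen_g gen_h).
by move=> c; rewrite g0 h0.
Qed.

Lemma homogeneous_isomorphic m (M : lmodType int) :
  finitely_generated M -> Zmod_homogeneous m M ->
  exists n, isomorphic M (direct_power n (Zmod m)).
Proof.
move=> fgM homM; have [n [g bg]] := Zmod_homogeneous_basis fgM homM.
have [h bh] := direct_power_Zmod_basis n m.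
by exists n; apply: Zmod_basis_isomorphic bg bh.
Qed.

(** * Torsion and p-primary modules *)

Lemma coprime_annihilators (M : lmodType int) (a b : int) (x : M) :
  coprimez a b -> a *: x = 0 -> b *: x = 0 -> x = 0.
Proof.
move=> /coprimezP[[u v] /= uv] ax0 bx0.
by rewrite -[x]scale1r -uv scalerDl -!scalerA ax0 bx0 !scaler0 addr0.
Qed.

Lemma prime_coprimez p (a : int) :
  prime p -> ~~ (p%:Z %| a)%Z -> coprimez p%:Z a.
Proof.
move=> pr_p Npa.
by rewrite /coprimez /gcdz eqz_nat -/(coprime _ _) prime_coprime.
Qed.

Lemma prime_annihilator (M : lmodType int) p (a : int) (x : M) :
  prime p -> x != 0 -> p%:Z *: x = 0 -> a *: x = 0 -> (p%:Z %| a)%Z.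
Proof.
move=> pr_p /eqP x0 px0 ax0.
apply: contrapT => /negP /(prime_coprimez pr_p) co_pa.
exact/x0/(coprime_annihilators co_pa).
Qed.

(** Let [m] be the least positive annihilator of [x] and [p] a prime factor of [m]. Then [m / p]
    does not kill [x], and [z] is that multiple of [x]. *)
Lemma torsion_prime (M : lmodType int) (a : int) (x : M) :
  a != 0 -> x != 0 -> a *: x = 0 ->
  exists p (z : M), [/\ prime p, z != 0 & p%:Z *: z = 0].
Proof.
move=> a0 x0 ax0.
have exP : exists m : nat, (0 < m)%N && (m%:Z *: x == 0).
  by exists `|a|%N; rewrite absz_gt0 a0 abszEsg -scalerA ax0 scaler0 eqxx.
have [m /andP[m_gt0 /eqP mx0] m_min] := ex_minnP exP.
have m_gt1 : (1 < m)%N.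
  case: m m_gt0 mx0 {m_min} => [|[|m]] //; rewrite scale1r => _ /eqP.
  by rewrite (negPf x0).
have pr_p := pdiv_prime m_gt1; have /dvdnP[q mE] := pdiv_dvd m.
exists (pdiv m), (q%:Z *: x); split=> //.
  2: by rewrite scalerA -PoszM mulnC -mE.
have q_gt0 : (0 < q)%N by case: q mE m_gt0 => // ->.
apply/negP => qx0; have := m_min q; rewrite q_gt0 qx0 => /(_ isT).
by rewrite leqNgt {1}mE ltn_Pmulr ?prime_gt1.
Qed.

(** A first comparison with [z] gives [y] a nonzero annihilator; a second one, applied to [y] with
    the [p]-part removed, excludes factors prime to [p]. *)
Lemma weakly_uniserial_primary (M : lmodType int) p (z y : M) :
  weakly_uniserial M -> prime p -> z != 0 -> p%:Z *: z = 0 ->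
  exists k, Posz (p ^ k) *: y = 0.
Proof.
move=> wuM pr_p z0 pz0.
have [b [yz|zy]] := weakly_uniserial_elements y z wuM.
  by exists 1%N; apply/yz; rewrite scalerA mulrC -scalerA pz0 scaler0.
have b0 : b != 0.
  apply: contraNneq z0 => b0; apply/eqP; rewrite -[z]scale1r; apply/zy.
  by rewrite b0 scale0r scaler0.
have pby : p%:Z *: (b *: y) = 0 by apply/zy.
have m_gt0 : (0 < p * `|b|)%N by rewrite muln_gt0 prime_gt0 // absz_gt0.
have my0 : Posz (p * `|b|) *: y = 0.
  by rewrite PoszM abszEsg mulrCA -!scalerA pby scaler0.
have [r co_pr mE] := pfactor_coprime pr_p m_gt0.
set k := logn _ _ in mE; pose w := Posz (p ^ k) *: y.
have rw0 : r%:Z *: w = 0 by rewrite scalerA -PoszM -mE.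
(* Either [p] kills [w], or [r] kills [z]; the latter is impossible because [p] kills [z] and is
   coprime to [r]. *)
have [c [wz|zw]] := weakly_uniserial_elements w z wuM.
  exists k.+1; rewrite expnS PoszM -scalerA; apply/wz.
  by rewrite scalerA mulrC -scalerA pz0 scaler0.
have rz0 : r%:Z *: z = 0.
  by apply/zw; rewrite scalerA mulrC -scalerA rw0 scaler0.
by case/eqP: z0; apply: (@coprime_annihilators _ p%:Z r%:Z).
Qed.

Lemma exponent_le (M : lmodType int) p k l (x : M) :
  (k <= l)%N -> Posz (p ^ k) *: x = 0 -> Posz (p ^ l) *: x = 0.
Proof.
by move=> le_kl x0; rewrite -(subnK le_kl) expnD PoszM -scalerA x0 scaler0.
Qed.

Lemma primary_bounded_exponent (M : lmodType int) p :
  finitely_generated M -> (forall y : M, exists k, Posz (p ^ k) *: y = 0) ->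
  exists N, forall y : M, Posz (p ^ N) *: y = 0.
Proof.
move=> [n [g gen_g]] primM; have [k kE] := choice (fun i => primM (g i)).
exists (\max_(i < n) k i)%N => y; have [c ->] := gen_g y.
rewrite scaler_sumr big1 // => i _; rewrite scalerA mulrC -scalerA.
by rewrite (exponent_le _ (kE i)) ?scaler0 // leq_bigmax.
Qed.

(** * Cyclicity in the presence of an element of order p^2 *)

(** Since [p] does not kill [x], Zx cannot embed into M[p]. So M[p] embeds into Zx, and its image
    lies in the multiples of [p%:Z *: x], a group of order [p]. *)
Lemma torsion_multiple (M : lmodType int) p (x : M) :
  weakly_uniserial M -> prime p -> p%:Z *: x != 0 ->
  p%:Z *: (p%:Z *: x) = 0 ->
  forall v, p%:Z *: v = 0 -> exists a : int, v = a *: x.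
Proof.
move=> wuM pr_p px0 ppx0 v pv0.
have Tin y : p%:Z *: y = 0 -> y \in @torsion M p by move=> py0; apply/eqP.
have xx : x \in multiples x by apply/asboolP; exists 1; rewrite scale1r.
have [/embeds_submodule_val|/embeds_submodule_val] :=
  wuM (@torsion M p) (multiples x); move=> [f [f_inj f_in]]; last first.
  case/eqP: px0; have /eqP := f_in (Submodule xx).
  by rewrite -linearZ -[RHS](raddf0 f) => /f_inj/(congr1 val).
have fE y (py0 : p%:Z *: y = 0) :
    exists b : int, f (Submodule (Tin y py0)) = b *: (p%:Z *: x).
  have /asboolP[b bE] := f_in (Submodule (Tin y py0)).
  have : b *: (p%:Z *: x) = 0.
    rewrite scalerA mulrC -scalerA -bE -linearZ -[RHS](raddf0 f).
    by congr (f _); apply: val_inj.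
  move=> /(prime_annihilator pr_p px0 ppx0)/dvdzP[c cE].
  by exists c; rewrite bE cE scalerA.
have [a aE] := fE _ ppx0; have [b bE] := fE _ pv0.
have Npa : ~~ (p%:Z %| a)%Z.
  apply: contra px0 => /dvdzP[c cE]; move: aE.
  rewrite cE -scalerA ppx0 scaler0 -[RHS](raddf0 f).
  by move=> /f_inj/(congr1 val) /= ->.
(* As [u] inverts [a] modulo [p], the images of [v] and of [b * u] times [p%:Z *: x] agree. *)
have /coprimezP[[s u] /= su1] := prime_coprimez pr_p Npa.
exists (b * u * p%:Z).
have /f_inj/(congr1 val) :
    f (Submodule (Tin v pv0)) = f ((b * u) *: Submodule (Tin _ ppx0)).
  rewrite linearZ aE bE /=; move: (p%:Z *: x) {aE bE} (ppx0) => w pw0.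
  rewrite scalerA -{1}(mulr1 b) -su1 mulrDr scalerDl !mulrA.
  by rewrite -scalerA pw0 scaler0 add0r.
by move=> /= ->; rewrite -scalerA.
Qed.

(** Induction on [k] with [p ^ k] killing [y]: [p%:Z *: y] is some [a *: x], and once [a] is
    [b * p], the difference [y - b *: x] is killed by [p]. *)
Lemma primary_cyclic (M : lmodType int) p N (x : M) :
  prime p -> (forall y : M, Posz (p ^ N.+1) *: y = 0) ->
  Posz (p ^ N) *: x != 0 ->
  (forall v : M, p%:Z *: v = 0 -> exists a : int, v = a *: x) ->
  forall y : M, exists a : int, y = a *: x.
Proof.
move=> pr_p expM x0 tors_x y.
have := expM y; elim: N.+1 y => [|k IHk] y pky0.
  by exists 0; rewrite scale0r -[y]scale1r.
have [a aE] : exists a : int, p%:Z *: y = a *: x.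
  by apply: IHk; rewrite scalerA -PoszM -expnSr.
(* Maximality of the order of [x] enters here: [a] kills [p ^ N] times [x], an element of order
   [p]. *)
have /dvdzP[b bE] : (p%:Z %| a)%Z.
  apply: (prime_annihilator pr_p x0); first by rewrite scalerA -PoszM -expnS.
  by rewrite scalerA mulrC -scalerA -aE scalerA -PoszM -expnSr.
have [c cE] : exists c : int, y - b *: x = c *: x.
  by apply: tors_x; rewrite scalerBr scalerA mulrC -bE aE subrr.
by exists (c + b); rewrite scalerDl -cE subrK.
Qed.

Lemma cyclic_isomorphic (M : lmodType int) p N (x : M) :
  prime p -> Posz (p ^ N.+1) *: x = 0 -> Posz (p ^ N) *: x != 0 ->
  (forall y : M, exists a : int, y = a *: x) ->
  isomorphic M (Zmod (p ^ N.+1)).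
Proof.
move=> pr_p px0 x0 gen_x.
have ann_x (a : int) : a *: x = 0 <-> (Posz (p ^ N.+1) %| a)%Z.
  split=> [ax0|/dvdzP[c ->]]; last by rewrite -scalerA px0 scaler0.
  (* The gcd of [a] and [p ^ N.+1] is a power of [p] that kills [x], so its exponent exceeds [N]. *)
  have [u [v uv]] := Bezoutz a (Posz (p ^ N.+1)).
  have : gcdz a (Posz (p ^ N.+1)) *: x = 0.
    by rewrite -uv scalerDl -!scalerA ax0 px0 !scaler0 addr0.
  have [i le_iN gE] := dvdn_pfactor _ _ pr_p (dvdn_gcdr `|a| (p ^ N.+1)).
  rewrite /gcdz /= gE; have [le_iN'|lt_Ni] := leqP i N.
    by move=> /(exponent_le le_iN')/eqP; rewrite (negPf x0).
  move=> _; have -> : (p ^ N.+1 = gcdn `|a| (p ^ N.+1))%N.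
    by rewrite gE; congr (p ^ _)%N; apply/eqP; rewrite eqn_leq lt_Ni le_iN.
  by rewrite dvdzE dvdn_gcdl.
have [e be] := Zmod_has_basis (p ^ N.+1).
apply: (@Zmod_basis_isomorphic (p ^ N.+1) _ _ 1 (fun=> x)) be; split=> [y|c].
  by have [a ->] := gen_x y; exists (fun=> a); rewrite big_ord1.
by rewrite big_ord1 ann_x; split=> [c0 i|//]; rewrite (ord1 i).
Qed.

(** * The classification *)

Lemma weakly_uniserial_classification (M : lmodType int) :
  finitely_generated M -> weakly_uniserial M ->
  exists p n : nat, prime p /\
    (isomorphic M (direct_power n int^o) \/
     isomorphic M (direct_power n (Zmod p)) \/
     isomorphic M (Zmod (p ^ n))).
Proof.
move=> fgM wuM.
have [[a [x [a0 x0 ax0]]]|tf] := pselect (exists (a : int) (x : M),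
    [/\ a != 0, x != 0 & a *: x = 0]); last first.
  have [a x|n isoM] := @homogeneous_isomorphic 0 M fgM; last first.
    (* Any prime would do in the torsion-free case. *)
    by exists 2%N, n; split=> //; left.
  rewrite dvd0z; split=> [ax0|[/eqP->|->]]; rewrite ?scale0r ?scaler0 //.
  have [a0|a0] := eqVneq a 0; [by left | right].
  by apply/eqP/negPn/negP => x0; apply: tf; exists a, x.
have [p [z [pr_p z0 pz0]]] := torsion_prime a0 x0 ax0.
exists p.
have [N expM N_min] : exists2 N, forall y : M, Posz (p ^ N) *: y = 0 &
    forall k, (forall y : M, Posz (p ^ k) *: y = 0) -> (N <= k)%N.
  have [N0 expN0] := primary_bounded_exponent fgM
    (fun y => weakly_uniserial_primary y wuM pr_p z0 pz0).
  have exP : exists N, `[< forall y : M, Posz (p ^ N) *: y = 0 >].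
    by exists N0; apply/asboolP.
  have [N /asboolP expM N_min] := ex_minnP exP.
  by exists N => // k expk; apply: N_min; apply/asboolP.
(* Exponent 1 contradicts [z != 0], exponent [p] gives a vector space over Z/p, and a higher
   exponent the cyclic case. *)
case: N expM N_min => [|[|N]] expM N_min.
- by have := expM z; rewrite scale1r => /eqP; rewrite (negPf z0).
- have [b y|n isoM] := @homogeneous_isomorphic p M fgM; last first.
    by exists n; split=> //; right; left.
  split=> [by0|[/dvdzP[c ->]|->]]; last 2 first.
  + by rewrite -scalerA (expM y) scaler0.
  + exact: scaler0.
  have [y0|y0] := eqVneq y 0; [by right | left].
  exact: (prime_annihilator pr_p y0 (expM y) by0).
have [y y0] : exists y : M, Posz (p ^ N.+1) *: y != 0.
  apply: contrapT => Ny; suff /N_min : forall y : M, Posz (p ^ N.+1) *: y = 0.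
    by rewrite ltnn.
  move=> y.
  by apply/eqP/negPn/negP => y0; apply: Ny; exists y.
exists N.+2; split=> //; right; right.
apply: (cyclic_isomorphic pr_p (expM y) y0).
apply: (primary_cyclic pr_p expM y0) => v pv0.
(* As [y] has order [p ^ N.+2], its multiple by [p ^ N] has order [p ^ 2]. *)
have [||a' ->] := @torsion_multiple M p (Posz (p ^ N) *: y) wuM pr_p _ _ v pv0.
- by rewrite scalerA -PoszM -expnS.
- by rewrite !scalerA -!PoszM -mulnA -!expnS.
by exists (a' * Posz (p ^ N)); rewrite scalerA.
Qed.

Theorem corollary5p7 (M : lmodType int) (hM : finitely_generated M) :
  weakly_uniserial M <->
  exists p n : nat, prime p /\
    (isomorphic M (direct_power n int^o) \/
     isomorphic M (direct_power n (Zmod p)) \/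
     isomorphic M (Zmod (p ^ n))).
Proof.
split; first exact: weakly_uniserial_classification.
have hom m n : m = 0%N \/ prime m -> isomorphic M (direct_power n (Zmod m)) ->
    weakly_uniserial M.
  move=> m0p [f /bij_inj f_inj]; apply: (@homogeneous_weakly_uniserial m) => //.
  exact: (Zmod_homogeneous_inj f_inj (direct_power_homogeneous m0p)).
move=> [p [n [pr_p [isoM|[isoM|isoM]]]]].
(* [Zmod 0] computes to [int^o]. *)
- by apply: (hom 0%N n) => //; left.
- by apply: (hom p n) => //; right.
- exact: Zmod_prime_power_weakly_uniserial isoM.
Qed.
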